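(* For every fixed $\varepsilon>0$ there exists $n_0=n_0(\varepsilon)$ such that for every integer $n\ge n_0$ the following holds. Let $L$ be a cycle with cyclic vertex-sequence $v_1,\ldots,v_{2n}$ and let $M$ be a perfect matching between $\{v_1,\ldots,v_n\}$ and $\{v_{n+1},\ldots,v_{2n}\}$ (that is, $M$ is a set of $n$ pairwise disjoint pairs, each consisting of one vertex from $\{v_1,\ldots,v_n\}$ and one vertex from $\{v_{n+1},\ldots,v_{2n}\}$). Then there exists a path in the graph $L\cup M$ which uses at least $n^{1-\varepsilon}$ edges of $M$.
   Context: $L\cup M$ denotes the graph on vertex set $\{v_1,\ldots,v_{2n}\}$ whose edges are the edges of the cycle $L$ together with the edges of $M$. The edges of $M$ are allowed to coincide with edges of $L$. *)

(* Defs.v *)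
From mathcomp Require Import all_boot all_order all_algebra.
From mathcomp Require Import reals exp.

Set Implicit Arguments.
Unset Strict Implicit.
Unset Printing Implicit Defensive.

(* Graphs are given by their edge sets, an edge being a two-element set of
   vertices.  For [x != y], [[set x; y]] is the unordered pair xy. *)

Definition adjacent (T : finType) (E : {set {set T}}) : rel T :=
  fun x y => [set x; y] \in E.

(* [next v x] is the cyclic successor of [x] in [v], so the edge joining the
   last vertex of [v] to the first one is included. *)
Definition cycle_edges (T : finType) (v : seq T) : {set {set T}} :=
  [set [set x; next v x] | x in v].

Definition perfect_matching_between (T : finType) (n : nat) (A B : seq T)
    (M : {set {set T}}) : Prop :=
  [/\ #|M| = n,
      trivIset M
    & forall e, e \in M ->
        exists x y, [/\ x \in A, y \in B & e = [set x; y]]].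

Definition is_path (T : finType) (E : {set {set T}}) (p : seq T) : bool :=
  [&& p != [::], uniq p & sorted (adjacent E) p].

Definition path_edges (T : finType) (p : seq T) : {set {set T}} :=
  [set:: [seq [set xy.1; xy.2] | xy <- zip p (behead p)]].

(* Main.v *)
Require Import Defs.
From mathcomp Require Import all_boot all_order all_algebra.
From mathcomp Require Import reals exp.
From mathcomp Require Import zify ring.

Set Implicit Arguments.
Unset Strict Implicit.
Unset Printing Implicit Defensive.

(** Let A and B be the paths v_1, ..., v_n and v_(n+1), ..., v_(2n). The matching
    is a permutation pi from the positions of A to those of B, and a path with
    n ^ (1 - O(1/r)) matching edges is built for every fixed r.

    Letters. Cut B into intervals of constant length k, called letters. Each
    letter is matched to k points of A, and the path may jump in A from one of
    them to another one through the interval in B, which uses two matching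
    edges ([route_jump]). If every letter is used at most once, nothing else
    has to be checked in B: the task is to travel in A by walks and jumps,
    using as many letters as possible, the walks being disjoint.

    Rails. Subdivide A in base b into D = r (r + 1) levels of nested intervals,
    with b about n ^ (1/D). For k > r ^ D, each letter meets at least r + 1 of
    the b children of some interval ([spread_points]). By the pigeonhole
    principle, a fraction 1 / (D b ^ (r + 1)) of the letters have the same
    level and the same positions of r + 1 children. So A is a sequence of
    disjoint blocks, and the letters kept in one block have one point in each
    of r + 1 disjoint intervals of this block, its rails. It is enough to
    cross each block from left to right with a large gain ([long_route]).

    Crossing a block ([cross_block]). Let the block have m letters, let the
    rightmost rail be the exit rail, and number the others 0, ..., r - 1 from
    right to left. The walk goes along some rail j, then jumps to the exit
    rail by the letter that comes last on the rail j. The rails below j are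
    passed over by this jump, so they can be used for detours: leave the rail
    j by a letter, travel through letters and through pieces of the rails
    below j, and come back to the rail j a little further to the right.

    Detours. Cut every rail into parts, each made of s letters that are
    consecutive on this rail. A detour is a cycle of letters and parts in
    which the highest rail occurs once. If every part had at least t letters
    and there were no detour, then by induction the letters reachable from a
    given one through the rails below j would be at least t ^ j
    ([cluster_large]), which is absurd for j = r when t ^ r > m. Choosing
    detours greedily, and discarding parts that become smaller than t, gives
    disjoint detours that use a fraction of order 1 / t of the letters
    ([disjoint_detours], with s = 2 r t). The rail j is the one whose detours
    use the most letters.

    With t = b ^ (r + 1), of order n ^ (1/r), the total loss is a constant
    times b ^ (2 (r + 1)), of order n ^ (2/r), and r is chosen above
    3 / eps. *)

(** * Routes in two paths joined by a permutation *)

Section Routes.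
Variables (pi : nat -> nat) (k : nat).

(** The vertex (false, i) is the i-th vertex of A and (true, i) the i-th vertex
    of B, both counted from 0. The two edges of L that join A to B are left
    out, and neither A nor B is bounded on the right: being below n is
    imposed on routes through the sets of positions that they may visit. *)
Definition strip_adj : rel (bool * nat) := fun u v =>
  if u.1 == v.1 then (u.2 == v.2.+1) || (v.2 == u.2.+1)
  else if u.1 then pi v.2 == u.2 else pi u.2 == v.2.

Fixpoint switches (u : bool * nat) (p : seq (bool * nat)) : nat :=
  if p is v :: p' then (u.1 != v.1) + switches v p' else 0.

Lemma switches_cat u p q :
  switches u (p ++ q) = switches u p + switches (last u p) q.
Proof. by elim: p u => [|v p IH] u //=; rewrite IH addnA. Qed.

(** A route from the position u to the position w of A that stays, in A, inside
    P and, in B, inside the letters of L, and uses at least g matching edges.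
    Keeping track of letters rather than of positions of B is enough because a
    letter is crossed at most once. *)
Definition route (u w : nat) (P L : nat -> Prop) (g : nat) : Prop :=
  exists p,
    [/\ path strip_adj (false, u) p, last (false, u) p = (false, w),
        uniq ((false, u) :: p)
      & [/\ forall i, (false, i) \in (false, u) :: p -> P i,
            forall i, (true, i) \in (false, u) :: p -> L (i %/ k)
          & g <= switches (false, u) p]].

Definition hull (x y z : nat) : Prop := minn x y <= z <= maxn x y.

Lemma walk_exists side x y :
  exists p, [/\ path strip_adj (side, x) p, last (side, x) p = (side, y),
    uniq ((side, x) :: p)
    & forall v, v \in (side, x) :: p -> v.1 = side /\ hull x y v.2].
Proof.
have [d] := ubnP ((x - y) + (y - x)); elim: d x y => // d IH x y lt_d.
have [->|ne_xy] := eqVneq x y.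
  exists [::]; split=> // v; rewrite inE => /eqP -> /=.
  by rewrite /hull minnn maxnn leqnn.
pose x' := if x < y then x.+1 else x.-1.
have [|p [pth lst unq mem]] := IH x' y; first by rewrite /x'; case: (ltnP x y) => ?; lia.
exists ((side, x') :: p); split=> //.
- rewrite [path _ _ _]/= pth andbT /strip_adj /= eqxx /x'; case: (ltnP x y) => ?; lia.
- rewrite cons_uniq unq andbT.
  apply/negP => /mem [_]; rewrite /hull /x' /=; case: (ltnP x y) => ?; lia.
- move=> v; rewrite inE => /predU1P [-> /=|/mem [-> h]]; split=> //.
    rewrite /hull; lia.
  move: h; rewrite /hull /x'; case: (ltnP x y) => ?; lia.
Qed.

Lemma route_walk u w : route u w (hull u w) (fun=> False) 0.
Proof.
have [p [pth lst unq mem]] := walk_exists false u w.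
exists p; split=> //; split=> // i /mem [] //=.
Qed.

Lemma route_weaken u w (P P' L L' : nat -> Prop) g g' :
  route u w P L g -> (forall i, P i -> P' i) -> (forall l, L l -> L' l) ->
  g' <= g -> route u w P' L' g'.
Proof.
case=> p [pth lst unq [hP hL hg]] PP LL gg; exists p; split=> //; split=> [i|i|].
- by move/hP/PP.
- by move/hL/LL.
- exact: leq_trans hg.
Qed.

Lemma route_cat u w w' (P P' L L' : nat -> Prop) g g' :
  route u w P L g -> route w.+1 w' P' L' g' ->
  (forall i, P i -> P' i -> False) -> (forall l, L l -> L' l -> False) ->
  route u w' (fun i => P i \/ P' i) (fun l => L l \/ L' l) (g + g').
Proof.
case=> p [pth lst unq [hP hL hg]] [p' [pth' lst' unq' [hP' hL' hg']]] dP dL.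
exists (p ++ (false, w.+1) :: p'); split.
- by rewrite cat_path pth lst /= pth' andbT /strip_adj /= eqxx orbT.
- by rewrite last_cat.
- rewrite -cat_cons cat_uniq unq unq' andbT; apply/hasPn => -[[] i] hi; apply/negP => hi'.
    exact: dL (hL _ hi') (hL' _ hi).
  exact: dP (hP _ hi') (hP' _ hi).
- split=> [i|i|].
  + by rewrite -cat_cons mem_cat => /orP [/hP|/hP'] ?; [left | right].
  + by rewrite -cat_cons mem_cat => /orP [/hL|/hL'] ?; [left | right].
  + by rewrite switches_cat lst /= add0n leq_add.
Qed.

(** This is how matching edges are gained: two positions of A with the same
    letter are joined through the interval of B that forms this letter. The
    jump uses two matching edges, of which one is counted. *)
Lemma route_jump u a a' w (P L : nat -> Prop) g :
  route u a P L g -> pi a %/ k = pi a' %/ k -> ~ L (pi a %/ k) ->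
  (forall i, P i -> hull a' w i -> False) ->
  route u w (fun i => P i \/ hull a' w i) (fun l => L l \/ l = pi a %/ k) g.+1.
Proof.
case=> p [pth lst unq [hP hL hg]] eq_l nL dP.
have [q [pthq lstq unqq memq]] := walk_exists true (pi a) (pi a').
have [s [pths lsts unqs mems]] := walk_exists false a' w.
have letq i : hull (pi a) (pi a') i -> i %/ k = pi a %/ k.
  case/andP=> h1 h2; move: (leq_div2r k h1) (leq_div2r k h2).
  by case: (leqP (pi a) (pi a')) => _; rewrite -?eq_l => g1 g2; apply/eqP; rewrite eqn_leq g1 g2.
exists (p ++ ((true, pi a) :: q) ++ (false, a') :: s); split.
- rewrite cat_path pth lst /= cat_path pthq lstq /= pths.
  by rewrite /strip_adj /= !eqxx.
- by rewrite last_cat last_cat.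
- rewrite -cat_cons cat_uniq unq cat_uniq unqq unqs !andTb andbT.
  apply/andP; split.
    apply/hasPn => -[sd i]; rewrite mem_cat => /orP [/memq|/mems] [/= -> h]; apply/negP.
      by move/hL; rewrite letq.
    by move/hP/dP; apply.
  by apply/hasPn => -[sd i] /mems [/= -> _]; apply/negP => /memq [].
- split=> [i|i|].
  + rewrite -cat_cons !mem_cat => /orP [/hP|/orP [/memq[]|/mems[_ ?]]] //; [by left | by right].
  + rewrite -cat_cons !mem_cat => /orP [/hL|/orP [/memq[_ /letq]|/mems[]]] //; [by left | by right].
  + by rewrite switches_cat lst /= -ltnS; lia.
Qed.

End Routes.

(** * Detours in a family of partitions *)

Section Detours.
Variables (r : nat) (C Q : finType) (part : 'I_r -> C -> Q) (x : 'I_r -> C -> nat).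
Implicit Types (F : {set C}) (u v : 'I_r * C) (d : ('I_r * C) * seq ('I_r * C)).

(** C is a set of letters and [part i c] names the part of the rail i that
    contains the letter c; [linked F j] is the adjacency between letters of F
    that share a part of some rail below j. *)
Definition linked F (j : nat) : rel C := fun c c' =>
  [&& c \in F, c' \in F & [exists i : 'I_r, (i < j) && (part i c == part i c')]].

Definition cluster F j c : {set C} := [set c' | connect (linked F j) c c'].

Lemma linked_sym F j : connect_sym (linked F j).
Proof.
apply: sym_connect_sym => c c'; rewrite /linked andbCA.
by congr [&& _, _ & _]; apply: eq_existsb => i; rewrite eq_sym.
Qed.

Lemma linked_mono F (j j' : nat) : j <= j' ->
  subrel (connect (linked F j)) (connect (linked F j')).
Proof.
move=> le_jj; apply: connect_sub => c c' /and3P [Fc Fc' /existsP [i /andP [ltij e]]].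
apply: connect1; rewrite /linked Fc Fc' /=; apply/existsP; exists i.
by rewrite e (leq_trans ltij le_jj).
Qed.

Definition mates F i c : {set C} := [set c' in F | part i c' == part i c].

(** The t clusters below rail j that start from the letters of one part of rail
    j are disjoint: a common letter would link two letters of that part
    through the rails below j. One more rail thus multiplies the size of
    clusters by t. *)
Lemma cluster_large F t :
  (forall i c, c \in F -> t <= #|mates F i c|) ->
  (forall (i : 'I_r) c c', c \in F -> c' \in mates F i c -> c != c' ->
     ~~ connect (linked F i) c c') ->
  forall j c, j <= r -> c \in F -> t ^ j <= #|cluster F j c|.
Proof.
move=> large nodet; elim=> [|j IH] c ltjr Fc.
  rewrite expn0 card_gt0; apply/set0Pn; exists c; by rewrite inE connect0.
pose i := Ordinal ltjr.
rewrite expnS (@leq_trans (\sum_(c' in mates F i c) #|cluster F j c'|)) //.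
  apply: (@leq_trans (\sum_(c' in mates F i c) t ^ j)).
    by rewrite sum_nat_const leq_mul2r large ?orbT.
  apply: leq_sum => c'; rewrite inE => /andP [Fc' _]; exact: IH (ltnW ltjr) Fc'.
apply: (@leq_trans (\sum_(c' in mates F i c) \sum_z (z \in cluster F j c'))).
  by apply: leq_sum => c' _; rewrite -sum1_card big_mkcond.
rewrite exchange_big /= -sum1_card [leqRHS]big_mkcond /=.
apply: leq_sum => z _.
have [/exists_inP [c' Bc' zc']|none] := 
  boolP [exists c' in mates F i c, z \in cluster F j c'].
  rewrite (bigD1 c') //= zc' big1 ?addn0.
    case: ifPn => // /negP []; rewrite inE.
    apply: (@connect_trans _ _ c'); last by apply: linked_mono (leqnSn j) _ _ _; rewrite inE in zc'.
    apply: connect1; move: Bc'; rewrite inE => /andP [Fc' e].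
    by rewrite /linked Fc Fc'; apply/existsP; exists i; rewrite ltnSn eq_sym.
  move=> c'' /andP [Bc'' ne]; apply/eqP; rewrite eqb0; apply/negP => zc''.
  move: Bc' Bc''; rewrite !inE => /andP [Fc' /eqP e'] /andP [Fc'' /eqP e''].
  have /negP [] : ~~ connect (linked F i) c'' c'.
    by apply: nodet => //; rewrite inE Fc' e' e'' /=.
  rewrite !inE in zc' zc''; apply: connect_trans zc'' _.
  by rewrite linked_sym.
rewrite big1 ?leq0n // => c' Bc'; apply/eqP; rewrite eqb0; apply: contra none => zc'.
by apply/exists_inP; exists c'.
Qed.

(** A cluster of size t ^ r does not fit in F. *)
Lemma linked_pair F t : 0 < #|F| < t ^ r ->
  (forall i c, c \in F -> t <= #|mates F i c|) ->
  exists (i : 'I_r) (c c' : C),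
    [/\ c \in F, c' \in F, c != c', part i c = part i c' & connect (linked F i) c c'].
Proof.
case/andP=> /card_gt0P [c0 Fc0] ltFt large.
case: (boolP [exists i : 'I_r, [exists c, [exists c',
   [&& c \in F, c' \in F, c != c', part i c == part i c' & connect (linked F i) c c']]]]).
  by case/existsP=> i /existsP [c /existsP [c' /and5P [? ? ? /eqP ? ?]]]; exists i, c, c'.
move=> none; suff: t ^ r <= #|F| by rewrite leqNgt ltFt.
apply: leq_trans (cluster_large large _ (leqnn r) Fc0) _.
  move=> i c c' Fc; rewrite inE => /andP [Fc' /eqP e] ne; apply: contra none => con.
  apply/existsP; exists i; apply/existsP; exists c; apply/existsP; exists c'.
  by rewrite Fc Fc' ne e eqxx con.
apply: subset_leq_card; apply/subsetP => c; rewrite inE => /connectP [p pth ->].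
elim: p c0 Fc0 pth => //= c1 p IH c0 Fc0 /andP [/and3P [_ Fc1 _]]; exact: IH.
Qed.

(** In a chain of steps, the pair (i, c) stands for going to the letter c inside
    its part of the rail i. In a detour, the rail of the first pair is
    the one that the detour leaves and to which it returns. *)
Definition step (j : nat) : rel ('I_r * C) := fun u v =>
  (v.1 < j) && (part v.1 u.2 == part v.1 v.2).

Definition letters d : seq C := [seq v.2 | v <- d.1 :: d.2].
Definition parts d : seq ('I_r * Q) := [seq (v.1, part v.1 v.2) | v <- d.1 :: d.2].

(** Besides the cycle itself, a detour records that it returns further to the
    right: the walk along its rail can go on from there. *)
Definition detour F d : Prop :=
  [/\ path (step d.1.1) d.1 d.2, {subset letters d <= F},
      part d.1.1 (last d.1 d.2).2 = part d.1.1 d.1.2,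
      x d.1.1 d.1.2 < x d.1.1 (last d.1 d.2).2
    & uniq (letters d) /\ uniq (parts d)].

Lemma path_step_head j u u' w :
  u.2 = u'.2 -> path (step j) u w = path (step j) u' w.
Proof. by case: w => //= v w e; rewrite /step e. Qed.

Lemma path_step_lt j u v w : path (step j) u w -> v \in w -> v.1 < j.
Proof.
elim: w u => // v' w IH u /andP [/andP [ltv _] /IH {}IH].
by rewrite inE => /predU1P [->|].
Qed.

(** Shortcutting a path of linked letters: it need not return to a letter, and
    from a letter of a part it may go at once to the last letter of the path
    that is reached inside that part. *)
Lemma chain_of_link F (j i0 : 'I_r) c p :
  c \in F -> path (linked F j) c p ->
  exists w, [/\ path (step j) (i0, c) w, {subset [seq v.2 | v <- (i0, c) :: w] <= F},
    (last (i0, c) w).2 = last c p,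
    uniq [seq v.2 | v <- (i0, c) :: w]
    & uniq [seq (v.1, part v.1 v.2) | v <- w]].
Proof.
elim: p c i0 => [|c1 p IH] c i0 Fc.
  by move=> _; exists [::]; split=> // c'; rewrite inE => /eqP ->.
case/andP=> /and3P [_ Fc1 /existsP [i /andP [ltij /eqP e]]] /(IH _ i Fc1).
case=> w [pth sub lst unqc unqp].
have [cin|cnin] := boolP (c \in [seq v.2 | v <- (i, c1) :: w]).
  case/mapP: cin => v vin ec.
  case/splitPl: vin pth sub lst unqc unqp => w1 w2 lw1.
  rewrite cat_path last_cat -cat_cons !map_cat !cat_uniq lw1 => /andP [_ pth] sub.
  move=> lst /and3P [_ disj unqc] /and3P [_ _ unqp].
  exists w2; split=> //.
  - by rewrite (@path_step_head _ _ v).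
  - move=> c'; rewrite inE => /predU1P [-> //|c'in]; apply: sub.
    by rewrite mem_cat c'in orbT.
  - by rewrite [RHS]/= -lst; case: (w2).
  - rewrite map_cons cons_uniq unqc andbT; apply/negP => cin; case/hasP: disj.
    by exists c => //; rewrite ec -lw1 map_f ?mem_last.
have sub' (w' : seq ('I_r * C)) : {subset [seq v.2 | v <- w'] <= [seq v.2 | v <- (i, c1) :: w]} ->
    {subset [seq v.2 | v <- (i0, c) :: w'] <= F}.
  by move=> ss c'; rewrite inE => /predU1P [-> //|/ss /sub].
have [pin|pnin] := boolP ((i, part i c1) \in [seq (v.1, part v.1 v.2) | v <- w]).
  case/mapP: pin => v vin [ei ep].
  case/splitPr: vin pth sub lst unqc unqp cnin sub' => w1 w2.
  rewrite cat_path last_cat -cat_cons !map_cat !cat_uniq => /andP [_ /andP [/andP [ltvj _] pth]].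
  move=> sub lst /and3P [_ _ unqc] /and3P [_ _ unqp] cnin sub'.
  exists (v :: w2); split=> //.
  - by apply/andP; split; [rewrite /step ltvj /= -ep -ei e | exact: pth].
  - by apply: sub' => c' c'in; rewrite mem_cat c'in orbT.
  - rewrite map_cons cons_uniq [uniq _]unqc andbT; apply: contra cnin => cin.
    by rewrite mem_cat cin orbT.
exists ((i, c1) :: w); split=> //.
- by rewrite /= pth andbT /step ltij /= e.
- exact: sub'.
- by rewrite map_cons cons_uniq cnin.
- by rewrite map_cons cons_uniq pnin.
Qed.

Hypothesis x_inj : forall i, injective (x i).

Lemma detour_exists F t : 0 < #|F| < t ^ r ->
  (forall i c, c \in F -> t <= #|mates F i c|) -> exists d, detour F d.
Proof.
move=> Fpos large; have [i [c [c' [Fc Fc' ne e con]]]] := linked_pair Fpos large.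
wlog ltx : c c' Fc Fc' ne e con / x i c < x i c'.
  move=> W; have [|lt|/x_inj eqc] := ltngtP (x i c) (x i c'); first exact: W.
    by apply: (W c' c) => //; rewrite 1?eq_sym 1?linked_sym.
  by rewrite eqc eqxx in ne.
case/connectP: con => p pth ec'.
have [w [pthw sub lst unqc unqp]] := chain_of_link i Fc pth.
have lstw : (last (i, c) w).2 = c' by rewrite lst ec'.
exists ((i, c), w); split=> //; rewrite ?lstw //.
split=> //; rewrite /parts map_cons cons_uniq unqp andbT.
(* The steps stay in rails below i, so they avoid the part of departure. *)
apply/negP => /mapP [v vw [ei _]].
by have := path_step_lt pthw vw; rewrite -ei ltnn.
Qed.

Definition occupied F : {set 'I_r * Q} := [set p | [exists c in F, part p.1 c == p.2]].

(** Greedy choice. A part with fewer than t letters is removed at a cost of t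
    letters, which happens at most once for each part; when there is none left,
    a detour exists, and all the letters of the parts that it visits are
    removed. As a detour visits as many parts as it uses letters, this costs s
    letters for each letter used, however long the detour is. *)
Lemma disjoint_detours F s t :
  (forall i q, #|[set c in F | part i c == q]| <= s) -> #|F| < t ^ r ->
  exists ds, [/\ forall d, d \in ds -> detour F d,
     uniq (flatten [seq letters d | d <- ds]),
     uniq (flatten [seq parts d | d <- ds])
   & #|F| <= s * (\sum_(d <- ds) size (letters d)) + t * #|occupied F|].
Proof.
have [m] := ubnP #|F|; elim: m F => // m IH F ltFm small ltFt.
have shrink (F' : {set C}) : F' \proper F ->
    exists ds, [/\ forall d, d \in ds -> detour F' d,
     uniq (flatten [seq letters d | d <- ds]),
     uniq (flatten [seq parts d | d <- ds])
   & #|F'| <= s * (\sum_(d <- ds) size (letters d)) + t * #|occupied F'|].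
  move=> prF; have ltF := proper_card prF; have /subsetP sF := proper_sub prF.
  apply: IH; [exact: leq_trans ltF _ | | exact: ltn_trans ltFt].
  move=> i q; apply: leq_trans (small i q); apply/subset_leq_card/subsetP => c.
  by rewrite !inE => /andP [/sF -> ->].
have occS (F' : {set C}) : F' \subset F -> occupied F' \subset occupied F.
  move=> /subsetP sF; apply/subsetP => p; rewrite !inE => /exists_inP [c /sF Fc e].
  by apply/exists_inP; exists c.
have detS (F' : {set C}) d : F' \subset F -> detour F' d -> detour F d.
  by move=> /subsetP sF [h1 h2 h3 h4 h5]; split=> // c /h2 /sF.
have [F0|Fpos] := posnP #|F|.
  exists [::]; split=> //; by rewrite F0.
case: (boolP [exists i : 'I_r, [exists c, (c \in F) && (#|mates F i c| < t)]]).
  case/existsP=> i /existsP [c /andP [Fc ltB]].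
  pose F' := F :\: mates F i c.
  have sF' : F' \subset F by exact: subsetDl.
  have cB : c \in mates F i c by rewrite inE Fc eqxx.
  have prF : F' \proper F.
    by apply/properP; split=> //; exists c => //; rewrite inE cB.
  have [ds [det unqc unqp le]] := shrink F' prF.
  exists ds; split=> //; first by move=> d /det; exact: detS.
  have : #|occupied F'| < #|occupied F|.
    apply: proper_card; apply/properP; split; first exact: occS.
    exists (i, part i c); first by rewrite inE; apply/exists_inP; exists c => /=.
    apply/negP; rewrite inE => /exists_inP [c']; rewrite !inE => /andP [nB Fc'] /= ep.
    by move: nB; rewrite Fc' ep.
  have : #|F| = #|mates F i c| + #|F'|.
    rewrite -(cardsID (mates F i c) F); congr (_ + _).
    by apply: eq_card => c'; rewrite !inE; case: (c' \in F).
  by nia.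
rewrite negb_exists => /forallP large.
have [||d det] := @detour_exists F t; first by rewrite Fpos.
  move=> i c Fc; move: (large i); rewrite negb_exists => /forallP /(_ c).
  by rewrite Fc -leqNgt.
pose touched := [set c in F | has (fun p => part p.1 c == p.2) (parts d)].
pose F' := F :\: touched.
have sF' : F' \subset F by exact: subsetDl.
have [pth sub eqp ltx [unqc unqp]] := det.
have letT c : c \in letters d -> c \in touched.
  move=> cd; rewrite inE sub //; case/mapP: cd => v vd ->.
  by apply/hasP; exists (v.1, part v.1 v.2) => //=; apply/mapP; exists v.
have prF : F' \proper F.
  apply/properP; split=> //; exists d.1.2; first by apply: sub; rewrite inE eqxx.
  by rewrite in_setD letT // inE eqxx.
have [ds [dets unqcs unqps le]] := shrink F' prF.
exists (d :: ds); split.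
- by move=> d'; rewrite inE => /predU1P [-> //|/dets]; exact: detS.
- change (uniq (letters d ++ flatten [seq letters d0 | d0 <- ds])).
  rewrite cat_uniq unqc unqcs andbT; apply/hasPn => c /flatten_mapP [d' /dets det' cd'].
  apply/negP => /letT; case: det' => _ /(_ _ cd') + _ _ _.
  by rewrite inE => /andP [/negP].
- change (uniq (parts d ++ flatten [seq parts d0 | d0 <- ds])).
  rewrite cat_uniq unqp unqps andbT; apply/hasPn => p /flatten_mapP [d' /dets det' /mapP [v vd' ep]].
  apply/negP => pd; case: det' => _ /(_ v.2 (map_f _ vd')) + _ _ _.
  rewrite !inE => /andP [/negP nT Fv]; apply: nT; rewrite Fv andTb.
  by apply/hasP; exists p => //; rewrite ep.
rewrite big_cons; have -> : size (letters d) = size (parts d) by rewrite !size_map.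
have : #|touched| <= s * size (parts d).
  have -> : touched = \bigcup_(p <- parts d) [set c in F | part p.1 c == p.2].
    apply/setP => c; rewrite inE; elim: (parts d) => [|p ps IHp].
      by rewrite big_nil !inE andbF.
    by rewrite big_cons !inE -IHp /= andb_orr.
  elim: (parts d) => [|p ps IHp]; first by rewrite big_nil cards0.
  rewrite big_cons mulnS (leq_trans (leq_card_setU _ _)) //.
  by rewrite leq_add // small.
have : #|occupied F'| <= #|occupied F| by apply/subset_leq_card/occS.
have : #|F| = #|touched| + #|F'|.
  rewrite -(cardsID touched F); congr (_ + _).
  by apply: eq_card => c'; rewrite !inE; case: (c' \in F).
by nia.
Qed.
End Detours.

Lemma flatten_map_cons (S T : Type) (f : S -> seq T) a s :
  flatten [seq f b | b <- a :: s] = f a ++ flatten [seq f b | b <- s].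
Proof. by []. Qed.

(** * Crossing a block with rails *)

Section BlockCrossing.
Variables (pi : nat -> nat) (k N r : nat) (x : 'I_r -> 'I_N -> nat) (z : 'I_N -> nat).
Variables (F : {set 'I_N}) (lo hi : nat).
(* The position x j c is the point of the letter c on the rail j, and z c its
   point on the exit rail. Rails are numbered from right to left and the exit
   rail is the rightmost one. *)
Hypothesis x_letter : forall j c, pi (x j c) %/ k = c.
Hypothesis z_letter : forall c, pi (z c) %/ k = c.
Hypothesis x_sep : forall (i j : 'I_r) c c', c \in F -> c' \in F -> i < j -> x j c < x i c'.
Hypothesis z_sep : forall j c c', c \in F -> c' \in F -> x j c < z c'.
Hypothesis x_lo : forall j c, c \in F -> lo <= x j c.
Hypothesis z_hi : forall c, c \in F -> z c < hi.

Section Passing.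
Variables (G : {set 'I_N}) (P : nat) (part : 'I_r -> 'I_N -> 'I_P).
Hypothesis GF : {subset G <= F}.
Hypothesis part_mono : forall j c c',
  c \in G -> c' \in G -> x j c <= x j c' -> part j c <= part j c'.

Definition region (p : 'I_r * 'I_P) (i : nat) : Prop :=
  exists c c', [/\ c \in G, c' \in G, part p.1 c = p.2, part p.1 c' = p.2
                 & x p.1 c <= i <= x p.1 c'].

Lemma region_disjoint p q i : region p i -> region q i -> p = q.
Proof.
case: p q => [j a] [j' a'] [c1 [c2 [/= G1 G2 e1 e2 /andP [l1 l2]]]].
case=> [c3 [c4 [/= G3 G4 e3 e4 /andP [l3 l4]]]].
case: (ltngtP j j') => [lt|lt|/val_inj ej].
- have := x_sep (GF G4) (GF G1) lt; lia.
- have := x_sep (GF G2) (GF G3) lt; lia.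
- subst j'; congr (_, _); apply/val_inj/eqP => /=; rewrite eqn_leq; apply/andP; split.
    by rewrite -e1 -e4 part_mono // (leq_trans l1).
  by rewrite -e3 -e2 part_mono // (leq_trans l3).
Qed.

Lemma hull_region j c c' i : c \in G -> c' \in G -> part j c = part j c' ->
  hull (x j c) (x j c') i -> region (j, part j c') i.
Proof.
move=> Gc Gc' e; rewrite /hull => h.
have [le|lt] := leqP (x j c) (x j c'); [exists c, c' | exists c', c]; split=> //=; lia.
Qed.

Lemma region_right (j : 'I_r) (p : 'I_r * 'I_P) i c : c \in F -> p.1 < j -> region p i -> x j c < i.
Proof.
move=> Fc ltj [c1 [c2 [G1 _ _ _ /andP [l1 _]]]].
exact: leq_trans (x_sep Fc (GF G1) ltj) l1.
Qed.

Notation partsof w := [seq (v.1, part v.1 v.2) | v <- w].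

(** A chain is followed alternately in B, from one point of a letter to another
    one, and in A, inside a part. Its last letter is not used yet: it will
    bring the route back to the rail of departure. *)
Lemma route_chain (j : nat) w (i0 : 'I_r) (c0 : 'I_N) u a (A L : nat -> Prop) g :
  route pi k u a A L g -> pi a %/ k = c0 ->
  path (step part j) (i0, c0) w ->
  {subset [seq v.2 | v <- (i0, c0) :: w] <= G} ->
  uniq [seq v.2 | v <- (i0, c0) :: w] -> uniq (partsof w) ->
  (forall c, c \in [seq v.2 | v <- (i0, c0) :: w] -> ~ L c) ->
  (forall p i, p \in partsof w -> A i -> region p i -> False) ->
  exists a', pi a' %/ k = (last (i0, c0) w).2 /\
    route pi k u a' (fun i => A i \/ exists2 p, p \in partsof w & region p i)
      (fun l => L l \/ exists2 c : 'I_N, c \in [seq v.2 | v <- belast (i0, c0) w] & l = c)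
      (g + size w).
Proof.
elim: w i0 c0 a A L g => [|[i c] w IH] i0 c0 a A L g R ea pth sub unqc unqp nL dA.
  by exists a; split=> //; apply: route_weaken R _ _ _ => [l|l|]; [left | left | rewrite addn0].
have Gc0 : c0 \in G by apply: sub; rewrite inE eqxx.
have Gc : c \in G by apply: sub; rewrite !inE eqxx orbT.
case/andP: pth => /andP [_ /eqP /= epart] pth.
have R1 : route pi k u (x i c) (fun l => A l \/ hull (x i c0) (x i c) l)
    (fun l => L l \/ l = pi a %/ k) g.+1.
  apply: route_jump R _ _ _; first by rewrite x_letter.
    by rewrite ea; apply: nL; rewrite inE eqxx.
  move=> l Al /(hull_region Gc0 Gc epart); apply: dA Al; by rewrite inE eqxx.
have [|||||||a' [ea' R2]] := IH i c _ _ _ _ R1.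
- exact: x_letter.
- exact: pth.
- by move=> c' c'in; apply: sub; rewrite inE c'in orbT.
- by case/andP: unqc.
- by case/andP: unqp.
- move=> c' c'in [|e]; first by apply: nL; rewrite inE c'in orbT.
  have ec : c' = c0 by apply: val_inj; rewrite /= e ea.
  by move: c'in; rewrite ec; case/andP: unqc => /negP + _; exact.
- move=> p l pin [Al|/(hull_region Gc0 Gc epart) h] h'.
    by apply: dA Al h'; rewrite inE pin orbT.
  by have ep := region_disjoint h h'; move: pin; rewrite -ep; case/andP: unqp => /negP + _; exact.
exists a'; split=> //; apply: route_weaken R2 _ _ _ => [l|l|].
- case=> [[Al|/(hull_region Gc0 Gc epart) h]|[p pin h]]; first by left.
    by right; exists (i, part i c) => //; rewrite inE eqxx.
  by right; exists p => //; rewrite inE pin orbT.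
- case=> [[Ll|->]|[c' c'in ->]]; first by left.
    by right; exists c0; rewrite ?inE ?eqxx.
  by right; exists c' => //; rewrite inE c'in orbT.
- by rewrite /= addnS.
Qed.

Implicit Types (U : seq ('I_r * 'I_P)) (S : seq 'I_N).

(** The state of the walk along a rail: every position of A up to y is given up,
    and to the right of y only the parts in U have been visited. *)
Definition reaches y U S g : Prop :=
  route pi k lo y (fun i => lo <= i <= y \/ exists2 p, p \in U & region p i)
    (fun l => exists2 c, c \in S & l = c) g.

Lemma reaches_walk (j : 'I_r) y c U S g : c \in F -> (forall p, p \in U -> p.1 < j) ->
  lo <= y <= x j c -> reaches y U S g -> reaches (x j c) U S g.
Proof.
move=> Fc ltU /andP [loy]; rewrite leq_eqVlt => /predU1P [-> //|lty] R.
apply: (route_weaken (route_cat R (route_walk pi k y.+1 (x j c)) _ _)) => //.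
- move=> i [le|[p pU h]]; rewrite /hull; first by lia.
  by have := region_right Fc (ltU p pU) h; lia.
- by move=> i [[le|h]|]; rewrite /hull; [left; lia | by right | left; lia].
- by move=> l [].
- by rewrite addn0.
Qed.

Lemma reaches_detour (j : 'I_r) y U S g d : (forall p, p \in U -> p.1 < j) ->
  d.1.1 = j -> detour part x G d -> lo <= y <= x j d.1.2 ->
  (forall p, p \in parts part d -> p \notin U) ->
  (forall c, c \in letters d -> c \notin S) ->
  reaches y U S g ->
  reaches (x j (last d.1 d.2).2) (U ++ partsof d.2) (S ++ letters d)
    (g + size (letters d)).
Proof.
case: d => [[j' c0] w] ltU /= -> [/= pth sub eqp ltx [unqc unqp]] ley nU nS R.
have Gc0 : c0 \in G by apply: sub; rewrite inE eqxx.
have ltw p : p \in partsof w -> p.1 < j.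
  by case/mapP => v vw ->; exact: path_step_lt pth vw.
have {}R := reaches_walk (GF Gc0) ltU ley R.
have [|||||a [ea R1]] := route_chain R (x_letter j c0) pth.
- exact: sub.
- exact: unqc.
- by case/andP: unqp.
- by move=> c cd [c' c'S /val_inj e]; case/negP: (nS c cd); rewrite e.
- move=> p i pw [le|[q qU h]] h'.
    have := region_right (GF Gc0) (ltw p pw) h'; lia.
  have e := region_disjoint h h'; have pin : p \in parts part ((j, c0), w) by rewrite inE pw orbT.
  by case/negP: (nU p pin); rewrite -e.
set cl := (last _ _).2 in ea ltx eqp *.
have clw : cl \in [seq v.2 | v <- (j, c0) :: w] by rewrite map_f ?mem_last.
have Gcl : cl \in G by exact: sub.
have lettersE : letters ((j, c0), w) = rcons [seq v.2 | v <- belast (j, c0) w] cl.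
  by rewrite /letters [_ :: _]lastI map_rcons.
have clb : cl \notin [seq v.2 | v <- belast (j, c0) w].
  by have : uniq (letters ((j, c0), w)) := unqc; rewrite lettersE rcons_uniq => /andP [].
apply: (route_weaken (@route_jump _ _ _ _ (x j cl) (x j cl) _ _ _ R1 _ _ _)).
- by rewrite ea x_letter.
- rewrite ea => -[[c cS /val_inj e]|[c cb /val_inj e]].
    by case/negP: (nS cl clw); rewrite e.
  by case/negP: clb; rewrite e.
- move=> i; rewrite /hull minnn maxnn -eqn_leq => Ai /eqP ei.
  subst i; case: Ai => [[/andP [_ le]|[p pU h]]|[p pw h]]; 
    first by have := leq_trans ltx le; rewrite ltnn.
    by have := region_right (GF Gcl) (ltU p pU) h; rewrite ltnn.
  by have := region_right (GF Gcl) (ltw p pw) h; rewrite ltnn.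
- move=> i [[[/andP [le1 le2]|[p pU h]]|[p pw h]]|].
  + by left; rewrite le1 (leq_trans le2) // ltnW.
  + by right; exists p => //; rewrite mem_cat pU.
  + by right; exists p => //; rewrite mem_cat pw orbT.
  + by rewrite /hull minnn maxnn -eqn_leq => /eqP <-; left; rewrite x_lo ?leqnn // GF.
- move=> l [[[c cS ->]|[c cb ->]]|->].
  + by exists c => //; rewrite mem_cat cS.
  + exists c => //; rewrite mem_cat lettersE mem_rcons.
    by rewrite inE cb !orbT.
  + by exists cl; rewrite ?ea // mem_cat clw orbT.
- by rewrite size_map /= addnS.
Qed.

(** Detours of one rail are made from left to right; since they sit in distinct
    parts and parts are consecutive on the rail, the order of parts is the
    order of the points of departure and of return. *)
Lemma reaches_detours (j : 'I_r) ds y U S g :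
  reaches y U S g ->
  (forall p, p \in U -> p.1 < j) ->
  (forall d, d \in ds -> d.1.1 = j /\ detour part x G d) ->
  uniq (flatten [seq letters d | d <- ds]) ->
  uniq (flatten [seq parts part d | d <- ds]) ->
  sorted (fun d d' => part j d.1.2 <= part j d'.1.2) ds ->
  (forall d, d \in ds -> y <= x j d.1.2) -> lo <= y ->
  (forall p, p \in flatten [seq parts part d | d <- ds] -> p \notin U) ->
  (forall c, c \in flatten [seq letters d | d <- ds] -> c \notin S) ->
  exists y' U' S', [/\ reaches y' U' S' (g + \sum_(d <- ds) size (letters d)),
    forall p, p \in U' -> p.1 < j,
    forall c, c \in S' -> c \in S \/ c \in G
    & lo <= y' /\ (y' = y \/ exists2 c, c \in G & y' = x j c)].
Proof.
elim: ds y U S g => [|d ds IH] y U S g R ltU dets unqc unqp srt ley loy nU nS.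
  exists y, U, S; split=> //; [by rewrite big_nil addn0 | by move=> c; left | by split=> //; left].
have [ed det] := dets d (mem_head _ _).
have [pth sub eqp ltx [unqcd unqpd]] := det.
have letd c : c \in letters d -> c \in flatten [seq letters d0 | d0 <- d :: ds].
  by move=> cd; rewrite flatten_map_cons mem_cat cd.
have partd p : p \in parts part d -> p \in flatten [seq parts part d0 | d0 <- d :: ds].
  by move=> cd; rewrite flatten_map_cons mem_cat cd.
have lets c : c \in flatten [seq letters d0 | d0 <- ds] ->
    c \in flatten [seq letters d0 | d0 <- d :: ds].
  by move=> cd; rewrite flatten_map_cons mem_cat cd orbT.
have partss p : p \in flatten [seq parts part d0 | d0 <- ds] ->
    p \in flatten [seq parts part d0 | d0 <- d :: ds].
  by move=> cd; rewrite flatten_map_cons mem_cat cd orbT.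
have Gd : d.1.2 \in G by apply: sub; rewrite inE eqxx.
have Gl : (last d.1 d.2).2 \in G by apply: sub; rewrite map_f ?mem_last.
have tailp p : p \in partsof d.2 -> p \in parts part d by move=> h; rewrite inE h orbT.
have R1 := reaches_detour ltU ed det (introT andP (conj loy (ley d (mem_head _ _))))
  (fun p h => nU p (partd p h)) (fun c h => nS c (letd c h)) R.
move: unqc unqp; rewrite !flatten_map_cons !cat_uniq.
move=> /and3P [_ /hasPn dc unqc'] /and3P [_ /hasPn dp unqp'].
have [|||||||||y' [U' [S' [R2 hU hS [loy' hy]]]]] := IH _ _ _ _ R1.
- move=> p; rewrite mem_cat => /orP [/ltU //|/mapP [v vd ->] /=].
  by rewrite -ed; exact: path_step_lt pth vd.
- by move=> d' d'in; apply: dets; rewrite inE d'in orbT.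
- exact: unqc'.
- exact: unqp'.
- exact: path_sorted srt.
- move=> d' d'in; have [ed' det'] := dets d' (mem_behead (s := d :: ds) d'in).
  have [_ sub' _ _ _] := det'.
  have Gd' : d'.1.2 \in G by apply: sub'; rewrite inE eqxx.
  rewrite leqNgt; apply/negP => /ltnW /(part_mono Gd' Gl); rewrite -[j in part j (last _ _).2]ed eqp ed => le.
  have le' : part j d.1.2 <= part j d'.1.2.
    move: srt; rewrite /= path_sortedE; last by move=> ? ? ?; exact: leq_trans.
    by case/andP => /allP /(_ d' d'in).
  have e : part j d'.1.2 = part j d.1.2 by apply/val_inj/eqP; rewrite eqn_leq le le'.
  have pd : (j, part j d.1.2) \in flatten [seq parts part d0 | d0 <- ds].
    by apply/flatten_mapP; exists d' => //; rewrite inE ed' e eqxx.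
  by case/negP: (dp _ pd); rewrite inE ed eqxx.
- exact: x_lo (GF Gl).
- move=> p pin; rewrite mem_cat negb_or nU ?partss //=.
  by apply: contra (dp p pin); exact: tailp.
- move=> c cin; rewrite mem_cat negb_or nS ?lets //=; exact: dc.
exists y', U', S'; split=> //.
- by rewrite big_cons addnA.
- by move=> c /hS [|]; [rewrite mem_cat => /orP [|/sub]; [left | right] | right].
- split=> //; right; case: hy => [->|[c Gc ->]]; [by exists (last d.1 d.2).2 | by exists c].
Qed.
End Passing.


Lemma x_inj j : injective (x j).
Proof. by move=> c c' e; apply: val_inj; rewrite /= -(x_letter j c) e x_letter. Qed.

Definition rank j c := #|[set c' in F | x j c' < x j c]|.

Lemma rank_mono j c c' : x j c <= x j c' -> rank j c <= rank j c'.
Proof.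
move=> le; apply/subset_leq_card/subsetP => d; rewrite !inE => /andP [-> lt].
exact: leq_trans lt le.
Qed.

Lemma rank_inj j : {in F &, injective (rank j)}.
Proof.
have lt_rank c c' : c \in F -> x j c < x j c' -> rank j c < rank j c'.
  move=> Fc lt; apply: proper_card; apply/properP; split.
    by apply/subsetP => d; rewrite !inE => /andP [-> h]; exact: ltn_trans h lt.
  by exists c; rewrite !inE ?Fc //= ltnn.
move=> c c' Fc Fc' e; apply: (@x_inj j); apply/eqP.
by case: ltngtP => // /lt_rank; rewrite e ltnn => ->.
Qed.

(** Parts are intervals of ranks, hence disjoint intervals of the rail, and
    there are as few of them as their size allows. *)
Definition rank_part s j c : 'I_(#|F| %/ s).+1 := inord (rank j c %/ s).

Lemma rank_partE s j c : rank_part s j c = rank j c %/ s :> nat.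
Proof.
rewrite inordK // ltnS leq_div2r // subset_leq_card //.
by apply/subsetP => d; rewrite inE => /andP [].
Qed.

Lemma card_rank_part s j q : 0 < s ->
  #|[set c in F | rank_part s j c == q]| <= s.
Proof.
move=> s_gt0; set D := [set c in F | _].
have DF c : c \in enum D -> c \in F by rewrite mem_enum inE => /andP [].
rewrite cardE -(size_map (rank j)) -[leqRHS](size_iota (q * s)).
apply: uniq_leq_size.
  rewrite map_inj_in_uniq ?enum_uniq // => c c' /DF Fc /DF; exact: rank_inj.
move=> _ /mapP [c cD ->]; rewrite mem_enum inE in cD.
case/andP: cD => _ /eqP <-; rewrite rank_partE mem_iota leq_divM /=.
by rewrite -mulSnr -ltn_divLR.
Qed.

(** Walk along the rail j on which detours use the most letters, then leave
    through the exit rail by the letter that comes last on the rail j. This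
    exit jump passes over all the rails below j, and hence over everything
    that the detours visit outside the rail j. *)
Lemma cross_block t : 0 < r -> 0 < t -> #|F| < t ^ r -> lo < hi ->
  exists g, route pi k lo hi.-1 (fun i => lo <= i < hi)
              (fun l => exists2 c, c \in F & l = c) g
            /\ #|F| <= 4 * r ^ 2 * t * g.
Proof.
move=> r_gt0 t_gt0 ltF lthi.
have start : route pi k lo lo (fun i => lo <= i <= lo) (fun=> False) 0.
  apply: (route_weaken (route_walk pi k lo lo)) => // i.
  by rewrite /hull minnn maxnn.
have [F0|/card_gt0P [c0 Fc0]] := posnP #|F|.
  exists 0; rewrite F0; split=> //.
  apply: (route_weaken (route_walk pi k lo hi.-1)) => // i; rewrite /hull; lia.
(* The letters that may serve for the exit are withheld from the detours. *)
pose top j := [arg max_(c > c0 in F) x j c].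
have topF j : top j \in F by rewrite /top; case: arg_maxnP.
have top_max j c : c \in F -> x j c <= x j (top j).
  by rewrite /top; case: arg_maxnP => // d _ h /h.
(* With parts of this size, there are so few of them that parts with less than
   t letters contain together about half of the letters at most. *)
pose s := 2 * r * t; have s_gt0 : 0 < s by rewrite !muln_gt0 r_gt0 t_gt0.
pose G := F :\: [set top j | j : 'I_r].
have GF : {subset G <= F} by move=> c /setDP [].
have le_GF : #|G| <= #|F| by exact/subset_leq_card/subsetP.
have card_G : #|F| <= #|G| + r.
  rewrite -(cardsID [set top j | j : 'I_r] F) addnC leq_add2l.
  apply: leq_trans (subset_leq_card (subsetIr _ _)) _.
  by apply: leq_trans (leq_imset_card _ _) _; rewrite card_ord.
have pmono j c c' : c \in G -> c' \in G -> x j c <= x j c' ->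
    rank_part s j c <= rank_part s j c'.
  by move=> _ _ le; rewrite !rank_partE leq_div2r // rank_mono.
have [||ds [dets unqc unqp bound]] :=
  disjoint_detours x_inj (F := G) (s := s) (t := t) (part := rank_part s).
- move=> j q; apply: leq_trans (card_rank_part j q s_gt0); apply/subset_leq_card/subsetP => c.
  by rewrite !inE => /andP [/andP [_ ->] ->].
- exact: leq_ltn_trans ltF.
have [j bigj] : exists j : 'I_r,
    \sum_(d <- ds) size (letters d) <= r * \sum_(d <- ds | d.1.1 == j) size (letters d).
  pose f (j : 'I_r) := \sum_(d <- ds | d.1.1 == j) size (letters d).
  exists [arg max_(j > Ordinal r_gt0) f j]; case: arg_maxnP => // j _ maxj.
  rewrite (partition_big (fun d => d.1.1) predT) //=.
  apply: (@leq_trans (\sum_(i < r) f j)); last by rewrite sum_nat_const card_ord.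
  by apply: leq_sum => i _; exact: maxj.
pose leT (d d' : ('I_r * 'I_N) * seq ('I_r * 'I_N)) :=
  rank_part s j d.1.2 <= rank_part s j d'.1.2.
pose dj := sort leT [seq d <- ds | d.1.1 == j].
have perm_dj : perm_eq dj [seq d <- ds | d.1.1 == j] by rewrite perm_sort.
have mem_dj d : d \in dj -> d.1.1 = j /\ d \in ds.
  by rewrite (perm_mem perm_dj) mem_filter => /andP [/eqP].
have uniq_dj (T : eqType) (f : ('I_r * 'I_N) * seq ('I_r * 'I_N) -> seq T) :
    uniq (flatten [seq f d | d <- ds]) -> uniq (flatten [seq f d | d <- dj]).
  rewrite (perm_uniq (perm_flatten (perm_map f perm_dj))).
  apply: subseq_uniq; elim: (ds) => // d l IH.
  rewrite [filter _ _]/=; case: ifP => _; rewrite ?flatten_map_cons.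
    exact: cat_subseq.
  exact: subseq_trans IH (suffix_subseq _ _).
have [||||||||||y [U [S [R ltU subS [loy hy]]]]] :=
  @reaches_detours G _ (rank_part s) GF pmono j dj lo [::] [::] 0.
- by apply: (route_weaken start) => // i h; left.
- by [].
- by move=> d /mem_dj [ed /dets].
- exact: uniq_dj.
- exact: uniq_dj.
- by apply: sort_sorted => d d'; exact: leq_total.
- move=> d /mem_dj [_ /dets [_ sub _ _ _]]; apply: x_lo; apply: GF; apply: sub.
  by rewrite inE eqxx.
- by [].
- by [].
- by [].
have le_y : lo <= y <= x j (top j).
  rewrite loy; case: hy => [->|[c Gc ->]]; [exact/x_lo/topF | exact/top_max/GF].
have {R} := reaches_walk GF (topF j) ltU le_y R; rewrite add0n => R.
have hull_exit i : hull (z (top j)) hi.-1 i -> z (top j) <= i < hi.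
  by have := z_hi (topF j); rewrite /hull; lia.
exists (\sum_(d <- dj) size (letters d)).+1; split.
  apply: (route_weaken (@route_jump _ _ _ _ (z (top j)) hi.-1 _ _ _ R _ _ _)) => //.
  - by rewrite x_letter z_letter.
  - rewrite x_letter => -[c cS /val_inj e]; have := subS c cS.
    case=> //; rewrite -e => /setDP [_ /negP []]; exact: imset_f.
  - move=> i [/andP [_ le]|[p pU [c [c' [_ Gc' _ _ /andP [_ le]]]]]] /hull_exit /andP [zi _].
      by have := leq_trans (leq_ltn_trans le (z_sep j (topF j) (topF j))) zi; rewrite ltnn.
    by have := leq_trans (leq_ltn_trans le (z_sep p.1 (GF _ Gc') (topF j))) zi; rewrite ltnn.
  - move=> i [[/andP [le1 le2]|[p pU [c [c' [Gc Gc' _ _ /andP [le1 le2]]]]]]|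
               /hull_exit /andP [zi ->]].
    + rewrite le1 (leq_ltn_trans le2) //.
      rewrite (ltn_trans (z_sep j (topF j) (topF j))) //; exact/z_hi/topF.
    + rewrite (leq_trans (x_lo p.1 (GF _ Gc)) le1) (leq_ltn_trans le2) //.
      by rewrite (ltn_trans (z_sep p.1 (GF _ Gc') (topF j))) //; exact/z_hi/topF.
    + by rewrite andbT (leq_trans _ zi) // ltnW // (leq_ltn_trans (x_lo j (topF j))) // z_sep.
  - move=> l [[c /subS [|/GF Fc] // ->]|->]; first by exists c.
    by exists (top j); rewrite ?x_letter.
rewrite (perm_big _ perm_dj) /= big_filter.
have : #|occupied (rank_part s) G| <= r * (#|F| %/ s).+1.
  by apply: leq_trans (max_card _) _; rewrite card_prod !card_ord.
have := leq_divM #|F| s; rewrite -/s.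
move: bigj bound card_G; set U0 := \sum_(d <- ds) size _.
set U1 := \sum_(d <- ds | d.1.1 == j) size _.
set o := #|occupied _ _|; set D := #|F| %/ s; rewrite /s => h1 h2 h3 h4 h5.
have h6 : t * o <= t * (r * D) + r * t.
  by rewrite [r * t]mulnC -mulnDr -mulnSr leq_mul2l h5 orbT.
have h7 : 2 * r * t * U0 <= 2 * (r ^ 2 * t * U1).
  have -> : 2 * (r ^ 2 * t * U1) = 2 * r * t * (r * U1) by ring.
  by rewrite leq_mul2l h1 orbT.
have h8 : 2 * (t * (r * D)) <= #|F|.
  by apply: leq_trans h4; rewrite leq_eqVlt; apply/orP; left; apply/eqP; ring.
have h9 : r <= r * t by rewrite leq_pmulr.
have h10 : r * t <= r ^ 2 * t by rewrite leq_mul2r -[leqLHS]expn1 leq_pexp2l ?orbT.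
have -> : 4 * r ^ 2 * t * U1.+1 = 4 * (r ^ 2 * t * U1) + 4 * (r ^ 2 * t) by ring.
move: h2 h3 h6 h7 h8 h9 h10.
move: (r ^ 2 * t * U1) (r ^ 2 * t) (2 * r * t * U0) (t * o) (t * (r * D)) (r * t).
move: #|F| #|G|; clear; lia.
Qed.
End BlockCrossing.

(** * From letters to rails *)

Lemma size_le_fibers (T : eqType) (f : nat -> T) (X : seq nat) m :
  (forall v, count (fun i => f i == v) X <= m) ->
  size X <= size (undup [seq f i | i <- X]) * m.
Proof.
move=> small; rewrite -(size_map f) -(perm_size (perm_count_undup _)).
elim: (undup _) => //= v s IH; rewrite size_cat size_nseq mulSn leq_add //.
by rewrite count_map; exact: small.
Qed.

(** In the tree of b-adic intervals, whose leaves are single positions, a set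
    that meets at most r children of every node has at most r ^ D elements. *)
Lemma spread_points b r D (X : seq nat) q :
  uniq X -> r ^ D < size X -> (forall i, i \in X -> i %/ b ^ D = q) ->
  exists l q' s, [/\ l < D, size s = r.+1, {subset s <= X},
    forall u, u \in s -> u %/ b ^ l.+1 = q'
    & sorted (fun u v => v %/ b ^ l < u %/ b ^ l) s].
Proof.
elim: D X q => [|D IH] X q unqX ltX sameX.
  suff : size X <= size [:: q] by rewrite leqNgt ltX.
  apply: uniq_leq_size => // i iX; rewrite inE -(sameX i iX) expn0 divn1 //.
pose f i := i %/ b ^ D; pose V := undup [seq f i | i <- X].
have [ltrV|leVr] := ltnP r (size V).
  pose rep v := nth 0 X (find (fun i => f i == v) X).
  have repP v : v \in V -> rep v \in X /\ f (rep v) = v.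
    rewrite mem_undup => /mapP [i iX ->].
    have hs : has (fun i' => f i' == f i) X by apply/hasP; exists i.
    by split; [apply: mem_nth; rewrite -has_find | apply/eqP/(nth_find 0 hs)].
  pose vs := take r.+1 (sort geq V).
  have vsV v : v \in vs -> v \in V by move/mem_take; rewrite mem_sort.
  exists D, q, (map rep vs); split=> //.
  - by rewrite size_map size_takel // size_sort.
  - by move=> _ /mapP [v /vsV /repP [? _] ->].
  - by move=> _ /mapP [v /vsV /repP [/sameX ? _] ->].
  - have : sorted gtn (map f (map rep vs)).
      have -> : map f (map rep vs) = vs.
        by rewrite -map_comp map_id_in // => v /vsV /repP [].
      apply: take_sorted; rewrite gtn_sorted_uniq_geq sort_uniq undup_uniq /=.
      by apply: sort_sorted => u v; exact: leq_total.
    by rewrite sorted_map.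
have [v ltv] : exists v, r ^ D < count (fun i => f i == v) X.
  have /hasP [v _ ltv] : has (fun v => r ^ D < count (fun i => f i == v) X) V.
    rewrite -[has _ _]negbK -all_predC; apply/negP => /allP small.
    have : size X <= size V * r ^ D.
      apply: size_le_fibers => v; have [/small /=|nv] := boolP (v \in V).
        by rewrite -leqNgt.
      rewrite leqNgt; apply: contra nv; rewrite mem_undup => lt.
      have /hasP [i iX /eqP <-] : has (fun i => f i == v) X.
        by rewrite has_count (leq_ltn_trans _ lt).
      exact: map_f.
    by rewrite leqNgt (leq_ltn_trans _ ltX) // expnS leq_mul2r leVr orbT.
  by exists v.
have [|||l [q' [s [ltl szs subs same srt]]]] := IH [seq i <- X | f i == v] v.
- exact: filter_uniq.
- by rewrite size_filter.
- by move=> i; rewrite mem_filter => /andP [/eqP].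
exists l, q', s; split=> //; first exact: leqW.
by move=> u /subs; rewrite mem_filter => /andP [].
Qed.

Section LongRoute.
Variables (n : nat) (pi : nat -> nat) (k r b D : nat).
Hypothesis pi_lt : forall i, i < n -> pi i < n.
Hypothesis pi_inj : forall i j, i < n -> j < n -> pi i = pi j -> i = j.
Hypotheses (k_gt : r ^ D < k) (b_gt0 : 0 < b) (n_le : n <= b ^ D).

Let N := n %/ k.

Lemma letter_points (c : 'I_N) :
  exists X : seq nat, [/\ uniq X, size X = k & forall i, i \in X -> i < n /\ pi i %/ k = c].
Proof.
have k_gt0 : 0 < k by exact: leq_ltn_trans k_gt.
have unq_pi : uniq [seq pi i | i <- iota 0 n].
  rewrite map_inj_in_uniq ?iota_uniq // => i j; rewrite !mem_iota; exact: pi_inj.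
have onto j : j < n -> j \in [seq pi i | i <- iota 0 n].
  have [||_ e] := @uniq_min_size _ [seq pi i | i <- iota 0 n] (iota 0 n) unq_pi.
  - by move=> _ /mapP [i ilt ->]; move: ilt; rewrite !mem_iota !add0n /=; exact: pi_lt.
  - by rewrite size_map.
  by move=> lt; rewrite e mem_iota.
pose Y := [seq i <- iota 0 n | pi i %/ k == c].
have : k <= size Y.
  rewrite -(size_map pi) -[leqLHS](size_iota (c * k)).
  apply: uniq_leq_size (iota_uniq _ _) _ => j; rewrite mem_iota => /andP [le lt].
  have : j < n.
    apply: leq_trans lt _; apply: leq_trans (leq_divM n k); rewrite -mulSnr leq_mul2r.
    by rewrite (ltn_ord c) orbT.
  move/onto => /mapP [i ilt ej]; apply/mapP; exists i => //.
  rewrite mem_filter ilt andbT -ej eqn_leq -ltnS ltn_divLR // mulSnr lt.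
  by rewrite leq_divRL.
move=> le; exists (take k Y); split.
- by apply: take_uniq; apply: filter_uniq; exact: iota_uniq.
- by rewrite size_takel.
- by move=> i /mem_take; rewrite mem_filter mem_iota => /andP [/eqP].
Qed.

(** The data attached to a letter: a level l and the indices of r + 1 children
    of a node of level l + 1, then the index q of this node and the points y
    of the letter in these children, from right to left. Only the first two
    are made common to all letters by the pigeonhole principle. *)
Definition spread (c : 'I_N) (t : ('I_D * {ffun 'I_r.+1 -> 'I_b}) * (nat * ('I_r.+1 -> nat))) :=
  let: ((l, pat), (q, y)) := t in
  (forall i j : 'I_r.+1, i < j -> pat j < pat i) /\
  (forall j, [/\ y j < n, pi (y j) %/ k = c & y j %/ b ^ l = q * b + pat j]).

Lemma spread_exists c : exists t, spread c t.
Proof.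
have [X [unqX szX inX]] := letter_points c.
have [||l [q [s [ltl szs subs same srt]]]] := @spread_points b r D X 0 unqX.
- by rewrite szX.
- by move=> i /inX [lt _]; rewrite divn_small // (leq_trans lt).
pose y (j : 'I_r.+1) := nth 0 s j.
have ys j : y j \in s by apply: mem_nth; rewrite szs.
have ydiv j : y j %/ b ^ l = q * b + y j %/ b ^ l %% b.
  by rewrite {1}(divn_eq (y j %/ b ^ l) b) -divnMA -expnSr same.
pose pat := [ffun j : 'I_r.+1 => Ordinal (ltn_pmod (y j %/ b ^ l) b_gt0)].
exists ((Ordinal ltl, pat), (q, y)); split=> [i j ltij|j].
  rewrite !ffunE /= -(ltn_add2l (q * b)) -!ydiv.
  apply: (sorted_ltn_nth _ _ srt) => //; rewrite ?inE ?szs //.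
  by move=> u v w h1 h2; exact: ltn_trans h2 h1.
by have [h1 h2] := inX _ (subs _ (ys j)); rewrite ffunE /= -ydiv.
Qed.

Lemma ltn_of_div d u v : u %/ d < v %/ d -> u < v.
Proof. by rewrite !ltnNge; apply: contra => /(leq_div2r d). Qed.

(** Letters with the same level and the same children are kept. In each node of
    the next level they have r + 1 common rails; these nodes are crossed in
    turn. *)
Lemma long_route t : 0 < n -> 0 < r -> 0 < t -> N < t ^ r ->
  exists g, route pi k 0 n.-1 (fun i => i < n) (fun l => l < N) g
            /\ N <= D * b ^ r.+1 * (4 * r ^ 2 * t * g).
Proof.
move=> n_gt0 r_gt0 t_gt0 ltN.
have [N0|N_gt0] := posnP N.
  exists 0; rewrite N0; split=> //.
  by apply: (route_weaken (route_walk pi k 0 n.-1)) => // i; rewrite /hull; lia.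
have [T TP] := fin_all_exists spread_exists.
pose key c := (T c).1; pose q c := (T c).2.1; pose y c := (T c).2.2.
have [[l pat] popular] : exists key0, N <= D * b ^ r.+1 * #|[set c | key c == key0]|.
  have card_key : #|{: 'I_D * {ffun 'I_r.+1 -> 'I_b}}| = D * b ^ r.+1.
    by rewrite card_prod card_ffun !card_ord.
  exists [arg max_(key0 > key (Ordinal N_gt0)) #|[set c | key c == key0]|].
  case: arg_maxnP => // key0 _ maxk.
  rewrite -[leqLHS]card_ord -[leqLHS]sum1_card [leqLHS](partition_big key predT) //=.
  apply: (@leq_trans (\sum_(key1 : 'I_D * {ffun 'I_r.+1 -> 'I_b}) #|[set c | key c == key0]|));
    last by rewrite sum_nat_const card_key.
  apply: leq_sum => key1 _.
  rewrite sum1_card; apply: leq_trans (maxk key1 isT).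
  by apply/subset_leq_card/subsetP => c; rewrite inE.
pose F := [set c | key c == (l, pat)].
have FP c : c \in F -> (forall i j : 'I_r.+1, i < j -> pat j < pat i) /\
    forall j, [/\ y c j < n, pi (y c j) %/ k = c & y c j %/ b ^ l = q c * b + pat j].
  rewrite inE /q /y => /eqP e; have := TP c; move: e; rewrite /key /spread.
  by case: (T c) => [[l' pat'] [q' y']] /= [-> ->].
have yl c j : pi (y c j) %/ k = c.
  rewrite /y; have := TP c; rewrite /spread.
  by case: (T c) => [[l' pat'] [q' y']] /= [_ /(_ j) []].
pose B := b ^ l.+1.
have B_gt0 : 0 < B by rewrite expn_gt0 b_gt0.
have yB c j : c \in F -> y c j %/ B = q c.
  move=> Fc; have [_ /(_ j) [_ _ e]] := FP c Fc.
  by rewrite /B expnSr divnMA e divnMDl // divn_small ?addn0.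
pose hi m := minn (m.+1 * B) n.
have Fm m c : (c \in [set c in F | q c == m]) = (c \in F) && (q c == m) by rewrite inE.
have cross m : m * B < n -> exists g,
    route pi k (m * B) (hi m).-1 (fun i => m * B <= i < hi m)
      (fun l => exists2 c : 'I_N, c \in [set c in F | q c == m] & l = c) g /\
    #|[set c in F | q c == m]| <= 4 * r ^ 2 * t * g.
  move=> ltm; have sep (i j : 'I_r.+1) c c' : c \in [set c in F | q c == m] ->
      c' \in [set c in F | q c == m] -> i < j -> y c j < y c' i.
    rewrite 2!Fm => /andP [/FP [mono /(_ j) [_ _ e]] /eqP qc].
    case/andP=> /FP [_ /(_ i) [_ _ e']] /eqP qc' ltij.
    by apply: (@ltn_of_div (b ^ l)); rewrite e e' qc qc' ltn_add2l mono.
  have inB c j : c \in [set c in F | q c == m] -> m * B <= y c j < hi m.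
    rewrite inE => /andP [Fc /eqP <-]; have [_ /(_ j) [lt _ _]] := FP c Fc.
    by rewrite -(yB c j Fc) leq_divM /hi leq_min lt andbT -ltn_divLR // ltnSn.
  apply: (@cross_block pi k N r (fun j c => y c (lift ord0 j)) (fun c => y c ord0)) => //.
  - by move=> i j c c' Fc Fc' ltij; apply: sep => //; rewrite !lift0.
  - by move=> j c c' Fc Fc'; apply: sep => //; rewrite lift0.
  - by move=> j c /inB -/(_ (lift ord0 j)) /andP [].
  - by move=> c /inB -/(_ ord0) /andP [].
  - by apply: leq_ltn_trans ltN; apply: leq_trans (max_card _) _; rewrite card_ord.
  - rewrite /hi leq_min ltn_pmul2r // ltnSn /=; exact: ltm.
have walk m : m * B < n -> exists g,
    route pi k 0 (hi m).-1 (fun i => i < hi m)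
      (fun l => exists2 c : 'I_N, c \in [set c in F | q c <= m] & l = c) g /\
    #|[set c in F | q c <= m]| <= 4 * r ^ 2 * t * g.
  elim: m => [|m IH] ltm.
    have [g [R le]] := cross 0 ltm; exists g.
    have -> : [set c in F | q c <= 0] = [set c in F | q c == 0].
      by apply/setP => c; rewrite !inE leqn0.
    by split=> //; apply: (route_weaken R).
  have ltm' : m * B < n by apply: leq_ltn_trans ltm; rewrite leq_mul2r leqnSn orbT.
  have [g [R le]] := IH ltm'; have [g' [R' le']] := cross m.+1 ltm.
  have ehi : hi m = m.+1 * B by apply/minn_idPl/ltnW.
  have ehiS : (hi m).-1.+1 = m.+1 * B by rewrite ehi prednK // muln_gt0.
  rewrite -ehiS in R'.
  exists (g + g'); split.
    apply: (route_weaken (route_cat R R' _ _)) => //.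
    - by move=> i lt; rewrite ehiS -ehi leqNgt lt.
    - move=> _ [c cF ->] [c' c'F /val_inj e]; move: cF c'F; rewrite -e !inE.
      by case/andP => _ le1 /andP [_ /eqP e1]; rewrite e1 ltnn in le1.
    - move=> i [lt|/andP [_ //]]; apply: leq_trans lt _.
      by rewrite ehi leq_min leq_mul2r leqnSn orbT ltnW.
    - move=> _ [[c cF ->]|[c cF ->]]; exists c => //; move: cF; rewrite !inE.
        by case/andP => -> le1; rewrite leqW.
      by case/andP => -> /eqP ->; rewrite leqnn.
  rewrite mulnDr; apply: leq_trans (leq_add le le').
  rewrite -cardsUI -[leqLHS]addn0 leq_add // subset_leq_card //.
  by apply/subsetP => c; rewrite !inE => /andP [-> ]; rewrite leq_eqVlt ltnS orbC.
have [g [R le]] : exists g, route pi k 0 (hi (n.-1 %/ B)).-1 (fun i => i < hi (n.-1 %/ B))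
    (fun l => exists2 c : 'I_N, c \in [set c in F | q c <= n.-1 %/ B] & l = c) g /\
    #|[set c in F | q c <= n.-1 %/ B]| <= 4 * r ^ 2 * t * g.
  by apply: walk; rewrite (leq_ltn_trans (leq_divM _ _)) // ltn_predL.
have ehi : hi (n.-1 %/ B) = n.
  by apply/minn_idPr; rewrite -{1}(prednK n_gt0) -ltn_divLR.
exists g; rewrite ehi in R; split.
  by apply: (route_weaken R) => // _ [c _ ->].
apply: leq_trans popular _; rewrite leq_mul2l -/F; apply/orP; right.
apply: leq_trans le; apply/subset_leq_card/subsetP => c Fc.
rewrite inE Fc /= -(yB c ord0 Fc) leq_div2r // -ltnS prednK //.
by have [_ /(_ ord0) []] := FP c Fc.
Qed.
End LongRoute.

(** * Choice of the base *)

(** The constant is 2 k, as there are n %/ k letters, times D, from the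
    pigeonhole, times 4 r ^ 2, from the crossing of blocks, times
    2 ^ (2 (r + 1)), from comparing b with b - 1. *)
Definition loss r : nat :=
  8 * (r ^ (r * r.+1)).+1 * (r * r.+1) * r ^ 2 * 2 ^ (2 * r.+1).

Lemma loss_gt0 r : 0 < r -> 0 < loss r.
Proof. by move=> r_gt0; rewrite /loss !muln_gt0 r_gt0 !expn_gt0. Qed.

(** For the least b with n < b ^ D, where D = r (r + 1), the two factors
    b ^ r.+1 lost in the preceding bound, one in the pigeonhole and one as t,
    have a product of order n ^ (2 / r). A further factor n ^ (1 / r) absorbs
    the constants, so the gain g is at least n ^ (1 - 3 / r). *)
Lemma long_route_pow n (pi : nat -> nat) r :
  (forall i, i < n -> pi i < n) ->
  (forall i j, i < n -> j < n -> pi i = pi j -> i = j) ->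
  0 < r -> loss r ^ r <= n ->
  exists k g, route pi k 0 n.-1 (fun i => i < n) (fun l => l < n %/ k) g
              /\ n ^ r <= n ^ 3 * g ^ r.
Proof.
move=> pi_lt pi_inj r_gt0 large.
pose D := r * r.+1; pose k := (r ^ D).+1.
have D_gt0 : 0 < D by rewrite muln_gt0 r_gt0.
have n_gt0 : 0 < n by apply: leq_trans large; rewrite expn_gt0 loss_gt0.
have le_kn : k <= n.
  apply: leq_trans large; apply: (@leq_trans (loss r)); last first.
    by rewrite -[leqLHS]expn1 leq_pexp2l ?loss_gt0.
  have eloss : loss r = k * (8 * D * r ^ 2 * 2 ^ (2 * r.+1)).
    by rewrite /loss -/D -/k; ring.
  by move: (loss_gt0 r_gt0); rewrite eloss muln_gt0 => /andP [_]; exact: leq_pmulr.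
have ex_b : exists b, n < b ^ D.
  by exists n.+1; rewrite -[leqLHS]expn1 leq_pexp2l.
case: (ex_minnP ex_b) => b lt_nb min_b.
have b_gt1 : 1 < b.
  case: (b) lt_nb => [|[|]] //; first by rewrite exp0n.
  by rewrite exp1n ltnNge n_gt0.
pose b' := b.-1.
have le_b'n : b' ^ D <= n.
  by rewrite leqNgt; apply/negP => /min_b; rewrite /b'; lia.
have le_b : b <= 2 * b' by rewrite /b'; lia.
have [|||||g [R le]] := @long_route n pi k r b D pi_lt pi_inj _ _ _ (b ^ r.+1) n_gt0 r_gt0.
- by [].
- exact: ltnW b_gt1.
- exact: ltnW lt_nb.
- by rewrite expn_gt0 (ltnW b_gt1).
- by rewrite -expnM mulnC (leq_ltn_trans (leq_div n k)).
exists k, g; split=> //.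
have N_gt0 : 0 < n %/ k by rewrite divn_gt0.
have le_n : n <= 2 * k * (n %/ k).
  have : n < (n %/ k).+1 * k by rewrite -ltn_divLR.
  by nia.
have le_bb : b ^ r.+1 * b ^ r.+1 <= 2 ^ (2 * r.+1) * b' ^ (2 * r.+1).
  by rewrite -expnD addnn -mul2n -expnMn leq_exp2r.
have le_ng : n <= loss r * b' ^ (2 * r.+1) * g.
  apply: leq_trans le_n _.
  apply: (@leq_trans (2 * k * (D * (4 * r ^ 2) * (b ^ r.+1 * b ^ r.+1) * g))).
    by rewrite leq_mul2l (leq_trans le) ?orbT // leq_eqVlt; apply/orP; left; apply/eqP; ring.
  apply: (@leq_trans (2 * k * (D * (4 * r ^ 2) * (2 ^ (2 * r.+1) * b' ^ (2 * r.+1)) * g))).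
    by rewrite leq_mul2l leq_mul2r leq_mul2l le_bb !orbT.
  by rewrite leq_eqVlt; apply/orP; left; apply/eqP; rewrite /loss -/D -/k; ring.
have : n ^ r <= (loss r * b' ^ (2 * r.+1) * g) ^ r by rewrite leq_exp2r.
move=> h; apply: leq_trans h _; rewrite [leqLHS]expnMn leq_mul2r [n ^ 3]expnS; apply/orP; right.
rewrite expnMn; apply: leq_mul => //.
rewrite -expnM (_ : 2 * r.+1 * r = D * 2); last by rewrite /D; ring.
by rewrite expnM leq_exp2r.
Qed.

(** * Back to the graph *)

Section Graph.
Variables (T : finType) (v : seq T) (M : {set {set T}}) (n : nat) (x0 : T).
Hypotheses (size_v : size v = (2 * n)%N) (uniq_v : uniq v) (all_v : forall x, x \in v).
Hypothesis matching : perfect_matching_between n (take n v) (drop n v) M.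

Let a i := nth x0 v i.
Let b i := nth x0 v (n + i).

Lemma size_take_v : size (take n v) = n.
Proof. by rewrite size_takel // size_v; lia. Qed.

Lemma size_drop_v : size (drop n v) = n.
Proof. by rewrite size_drop size_v; lia. Qed.

Lemma take_drop_disjoint x : x \in take n v -> x \in drop n v -> False.
Proof.
move: uniq_v; rewrite -{1}(cat_take_drop n v) cat_uniq => /and3P [_ /hasPn disj _] xt xd.
by have := disj x xd; rewrite /= xt.
Qed.

Lemma matched x : exists2 e, e \in M & x \in e.
Proof.
have [cardM trivM edges] := matching.
have : cover M = setT.
  apply/eqP; rewrite eqEcard subsetT cardsT /=.
  have -> : #|T| = 2 * n.
    by rewrite -size_v -(card_uniqP uniq_v); apply: eq_card => y; rewrite all_v.
  rewrite -(eqP trivM) (eq_bigr (fun=> 2)) ?sum_nat_const ?cardM 1?mulnC // => e /edges.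
  case=> y [z [yt zd ->]]; rewrite cards2; case: eqP => // eyz.
  by case: (@take_drop_disjoint y); rewrite // eyz.
move/setP/(_ x); rewrite inE => /bigcupP [e eM xe]; by exists e.
Qed.

Lemma matching_perm : exists pi : nat -> nat,
  [/\ forall i, i < n -> pi i < n,
      forall i j, i < n -> j < n -> pi i = pi j -> i = j
    & forall i, i < n -> [set a i; b (pi i)] \in M].
Proof.
pose partner i j := [set a i; b j] \in M.
have ex i : i < n -> has (partner i) (iota 0 n).
  move=> ltin; have at_ : a i \in take n v.
    by rewrite /a -(nth_take x0 ltin) mem_nth // size_take_v.
  have [e eM ae] := matched (a i); have [_ _ /(_ e eM) [x [y [xt yd ee]]]] := matching.
  move: ae; rewrite ee => /set2P [ax|ay]; last by case: (take_drop_disjoint at_); rewrite ay.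
  apply/hasP; exists (index y (drop n v)).
    by rewrite mem_iota -[X in _ < _ + X]size_drop_v index_mem.
  by rewrite /partner /b -nth_drop nth_index // ax -ee.
pose pi i := find (partner i) (iota 0 n).
have pi_lt i : i < n -> pi i < n.
  by move/ex; rewrite has_find size_iota.
have piM i : i < n -> [set a i; b (pi i)] \in M.
  by move=> lt; have := nth_find 0 (ex i lt); rewrite nth_iota ?pi_lt.
exists pi; split=> // i j lti ltj e.
have [_ /trivIsetP triv _] := matching.
have eqe : [set a i; b (pi i)] = [set a j; b (pi j)].
  apply/eqP; case: (altP eqP) => // ne.
  have := triv _ _ (piM i lti) (piM j ltj) ne.
  by move/disjoint_setI0/setP/(_ (b (pi i))); rewrite !inE e !eqxx !orbT.
have : a i \in [set a j; b (pi j)] by rewrite -eqe !inE eqxx.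
have lt2 l : l < n -> l < size v by rewrite size_v; lia.
have ltb : n + pi j < size v by rewrite size_v; have := pi_lt j ltj; lia.
have [lsi lsj] := (lt2 i lti, lt2 j ltj).
by case/set2P => /eqP; rewrite /a /b nth_uniq // => /eqP; lia.
Qed.

Definition vertex (u : bool * nat) : T := if u.1 then b u.2 else a u.2.

Lemma vertex_nth u : vertex u = nth x0 v (u.1 * n + u.2).
Proof. by rewrite /vertex /a /b; case: u.1; rewrite ?mul1n ?mul0n. Qed.

Lemma vertex_inj u w : u.2 < n -> w.2 < n -> vertex u = vertex w -> u = w.
Proof.
case: u w => [s i] [s' j] /= lti ltj; rewrite !vertex_nth /= => /eqP.
by rewrite nth_uniq ?size_v //; case: s s' => [] [] /=; rewrite ?mul1n ?mul0n;
  move=> *; try congr (_, _); lia.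
Qed.

Lemma cycle_edge i : i.+1 < 2 * n -> [set nth x0 v i; nth x0 v i.+1] \in cycle_edges v.
Proof.
move=> lt; apply/imsetP; exists (nth x0 v i); first exact: all_v.
congr [set _; _]; rewrite next_nth all_v.
have lti : i < size v by rewrite size_v; lia.
case: v lti lt uniq_v size_v => // y s lti lt unq sz.
by rewrite index_uniq //= (set_nth_default x0) //; move: sz => /=; lia.
Qed.

Variable pi : nat -> nat.
Hypothesis piM : forall i, i < n -> [set a i; b (pi i)] \in M.

Lemma strip_switch u w : u.2 < n -> w.2 < n -> strip_adj pi u w -> u.1 != w.1 ->
  [set vertex u; vertex w] \in M.
Proof.
case: u w => [[] i] [[] j] //= lti ltj; rewrite /strip_adj /= => /eqP <- _.
  by rewrite /vertex /= setUC piM.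
by rewrite /vertex /= piM.
Qed.

Lemma strip_adjacent u w : u.2 < n -> w.2 < n -> strip_adj pi u w ->
  adjacent (cycle_edges v :|: M) (vertex u) (vertex w).
Proof.
move=> ltu ltw adj; rewrite /adjacent inE.
have [e|ne] := eqVneq u.1 w.1; last by rewrite (strip_switch ltu ltw adj ne) orbT.
apply/orP; left; move: adj; rewrite /strip_adj e eqxx !vertex_nth e.
case/orP => /eqP e2; rewrite e2 addnS; [rewrite setUC|]; rewrite cycle_edge //.
  by case: w.1 => /=; lia.
by case: w.1 => /=; lia.
Qed.

Lemma mem_zip (S U : eqType) (s : seq S) (t : seq U) p :
  p \in zip s t -> p.1 \in s /\ p.2 \in t.
Proof.
elim: s t => [|x s IH] [|y t] //; rewrite inE => /predU1P [->|/IH [h1 h2]] /=.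
  by rewrite !inE !eqxx.
by rewrite !inE h1 h2 !orbT.
Qed.

(** Distinct steps of a path are distinct edges, so that counting steps along
    the matching counts matching edges. *)
Lemma uniq_pair_edges (s : seq T) : uniq s ->
  uniq [seq [set xy.1; xy.2] | xy <- zip s (behead s)].
Proof.
elim: s => [|x [|y s] IH] // /andP [xs unq] /=; rewrite IH // andbT.
apply/negP => /mapP [[x' y'] /mem_zip /= [x's y's]] /setP /(_ x).
rewrite !inE eqxx /= => /esym /orP [] /eqP ex; move: xs; rewrite ex.
  by rewrite x's.
by rewrite inE y's orbT.
Qed.

Lemma route_path k g (L : nat -> Prop) u w : route pi k u w (fun i => i < n) L g ->
  (forall i, L (i %/ k) -> i < n) ->
  exists p, is_path (cycle_edges v :|: M) p /\ g <= #|path_edges p :&: M|.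
Proof.
case=> p [pth _ unq [hP hL hg]] letters_lt.
have inr x : x \in (false, u) :: p -> x.2 < n.
  by case: x => [[] i] /=; [move/hL/letters_lt | move/hP].
have unq' : uniq [seq vertex x | x <- (false, u) :: p].
  by rewrite map_inj_in_uniq // => x y /inr hx /inr hy; exact: vertex_inj.
exists [seq vertex x | x <- (false, u) :: p]; split.
  apply/and3P; split=> //; rewrite /sorted /= path_map.
  elim: p (false, u) pth inr {hP hL hg unq unq'} => //= y p IH x /andP [adj pth] inr.
  rewrite IH // ?andbT.
    by apply: strip_adjacent => //; apply: inr; rewrite !inE eqxx ?orbT.
  by move=> z zin; apply: inr; rewrite inE zin orbT.
apply: leq_trans hg _.
pose es (s : seq T) := [seq [set xy.1; xy.2] | xy <- zip s (behead s)].
have card_es s : uniq s -> #|path_edges s :&: M| = count (mem M) (es s).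
  move=> unqs; rewrite -size_filter -(card_uniqP (filter_uniq _ (uniq_pair_edges unqs))).
  by apply: eq_card => e; rewrite !inE mem_filter andbC.
rewrite card_es //; elim: p (false, u) pth inr {hP hL unq unq'} => //= y p IH x /andP [adj pth] inr.
apply: leq_add; last by apply: IH => // z zin; apply: inr; rewrite inE zin orbT.
have [//|ne] := eqVneq x.1 y.1.
by rewrite strip_switch // inr // !inE eqxx ?orbT.
Qed.
End Graph.

Import Order.TTheory GRing.Theory Num.Theory.
Local Open Scope ring_scope.

Theorem theorem1p3 (R : realType) (eps : R) (eps_gt0 : 0 < eps) :
  exists n0 : nat, forall n : nat, (n0 <= n)%N ->
  forall (T : finType) (v : seq T) (M : {set {set T}}),
    size v = (2 * n)%N -> uniq v -> (forall x : T, x \in v) ->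
    perfect_matching_between n (take n v) (drop n v) M ->
  exists p : seq T,
    is_path (cycle_edges v :|: M) p /\
    n%:R `^ (1 - eps) <= #|path_edges p :&: M|%:R :> R.
Proof.
pose r := Num.bound (3%:R / eps).
have r_gt : 3%:R / eps < r%:R by apply: archi_boundP; rewrite divr_ge0 // ltW.
have r_gt0 : (0 < r)%N by rewrite -(ltr0n R) (le_lt_trans _ r_gt) // divr_ge0 // ltW.
exists (loss r ^ r)%N => n large T v M size_v uniq_v all_v matching.
have n_gt0 : (0 < n)%N.
  by apply: leq_trans large; rewrite expn_gt0 loss_gt0.
have [x0 _] : exists x, x \in v.
  by case: v size_v {uniq_v all_v matching} => [|x v _];
    [case: (n) n_gt0 | exists x; rewrite inE eqxx].
have [pi [pi_lt pi_inj piM]] := matching_perm x0 size_v uniq_v all_v matching.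
have [k [g [rt le_g]]] := long_route_pow pi_lt pi_inj r_gt0 large.
have letters_lt i : (i %/ k < n %/ k -> i < n)%N by exact: ltn_of_div.
have [p [pp le_p]] := route_path size_v uniq_v all_v piM rt letters_lt.
exists p; split=> //; apply: le_trans (_ : g%:R <= _); last by rewrite ler_nat.
have n_ge1 : 1 <= n%:R :> R by rewrite ler1n.
have n_gt0R : 0 < n%:R :> R by rewrite ltr0n.
have rR_gt0 : 0 < r%:R :> R by rewrite ltr0n.
apply: (@le_trans _ _ (n%:R `^ (1 - 3%:R / r%:R))).
  apply: ler_powR => //; rewrite lerD2l lerN2 ler_pdivrMr //.
  by move: r_gt; rewrite ltr_pdivrMr // mulrC => /ltW.
rewrite -(@ler_pXn2r _ r) ?nnegrE ?powR_ge0 ?ler0n //.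
rewrite -(@ler_pM2l _ (n%:R ^+ 3)) ?exprn_gt0 //.
rewrite -!powR_mulrn ?powR_ge0 ?ler0n // -powRrM -powRD; last by rewrite (gt_eqF n_gt0R) implybT.
rewrite mulrBl mul1r divfK ?gt_eqF // addrC subrK !powR_mulrn ?ler0n //.
by rewrite -!natrX -natrM ler_nat.
Qed.
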